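(* Let $\mathbf H=(\underline H,\overline H,\tau)$ be a weak braided bimonad on a category $\mathbb A$, and put $\omega:=mH\cdot H\tau\cdot\delta H$ and $\overline\omega:=Hm\cdot\tau H\cdot H\delta$. Then - $(\underline H,\overline H,\omega)$ is a compatible weak (monad-comonad) entwining; - $(\overline H,\underline H,\overline\omega)$ is a compatible weak (comonad-monad) entwining.
   Context: Conventions. $\cdot$ is vertical composition of natural transformations; juxtaposition is composition of functors and whiskering, and $\varphi\psi$ is the horizontal composite of $\varphi,\psi$. $1$ is the identity. Weak YB-pair. For $H:\mathbb A\to\mathbb A$, natural transformations $\tau,\tau':HH\to HH$ form a weak YB-pair if $\tau\tau'\tau=\tau$, $\tau'\tau\tau'=\tau'$, $\tau\cdot\tau'=\tau'\cdot\tau$; $H\tau\cdot\tau H\cdot H\tau=\tau H\cdot H\tau\cdot\tau H$ and the same for $\tau'$; and, with $\nabla:=\tau\cdot\tau'$, $\tau H\cdot H\nabla=H\nabla\cdot\tau H$, $H\tau\cdot\nabla H=\nabla H\cdot H\tau$, and both equations with $\tau'$ in place of $\tau$. Weak braided bimonad. Let $\underline H=(H,m,e)$ be a monad and $\overline H=(H,\delta,\varepsilon)$ a comonad on $\mathbb A$ with the same endofunctor $H$, and $\tau,\tau'$ a weak YB-pair, $\nabla=\tau\cdot\tau'$. $\mathbf H=(\underline H,\overline H,\tau)$ is a weak braided bimonad if (1) $m\cdot\nabla=m$, $\nabla\cdot\delta=\delta$; (2) $\nabla\cdot He=\tau\cdot eH$, $H\varepsilon\cdot\nabla=\varepsilon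 H\cdot\tau$, $\nabla\cdot eH=\tau\cdot He$, $\varepsilon H\cdot\nabla=H\varepsilon\cdot\tau$; (3) $\delta H\cdot\tau=H\tau\cdot\tau H\cdot H\delta$, $\tau\cdot mH=Hm\cdot\tau H\cdot H\tau$; (4) $H\delta\cdot\tau=\tau H\cdot H\tau\cdot\delta H$, $\tau\cdot Hm=mH\cdot H\tau\cdot\tau H$; (5) $\delta\cdot m=mm\cdot H\tau H\cdot\delta\delta$; (6) $\varepsilon\varepsilon\cdot mm\cdot H\delta H=\varepsilon\cdot m\cdot mH=\varepsilon\varepsilon\cdot mm\cdot H\tau'H\cdot H\delta H$; (7) $HmH\cdot\delta\delta\cdot ee=\delta H\cdot\delta\cdot e=HmH\cdot H\tau'H\cdot\delta\delta\cdot ee$. Weak entwinings. With $\xi:=\varepsilon H\cdot\omega\cdot eH$, $(\underline H,\overline H,\omega)$ is a weak (monad-comonad) entwining if $\omega\cdot mH=Hm\cdot\omega H\cdot H\omega$, $\delta H\cdot\omega=H\omega\cdot\omega H\cdot H\delta$, $\omega\cdot eH=H\xi\cdot\delta$, $\varepsilon H\cdot\omega=m\cdot H\xi$; it is compatible if $\delta\cdot m=Hm\cdot\omega H\cdot H\delta$. With $\bar\xi:=H\varepsilon\cdot\overline\omega\cdot He$, $(\overline H,\underline H,\overline\omega)$ is a weak (comonad-monad) entwining if $\overline\omega\cdot Hm=mH\cdot H\overline\omega\cdot\overline\omega H$, $H\delta\cdot\overline\omega=\overline\omega H\cdot H\overline\omega\cdot\delta H$, $\overline\omega\cdot He=\bar\xi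 H\cdot\delta$, $H\varepsilon\cdot\overline\omega=m\cdot\bar\xi H$; it is compatible if $\delta\cdot m=mH\cdot H\overline\omega\cdot\delta H$. *)

(* Defs.v *)
Set Implicit Arguments.
Unset Strict Implicit.
Unset Printing Implicit Defensive.

Declare Scope cat_scope.
Delimit Scope cat_scope with cat.
Local Open Scope cat_scope.

Record Category := {
  obj :> Type;
  hom : obj -> obj -> Type;
  idm : forall x, hom x x;
  comp : forall x y z, hom y z -> hom x y -> hom x z;
  id_left : forall x y (f : hom x y), comp (idm y) f = f;
  id_right : forall x y (f : hom x y), comp f (idm x) = f;
  comp_assoc : forall x y z w (h : hom z w) (g : hom y z) (f : hom x y),
    comp h (comp g f) = comp (comp h g) f
}.

Arguments hom {_} _ _.
Arguments idm {_} _.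
Arguments comp {_ _ _ _} _ _.

(* The functor laws are kept apart from the data.  With primitive projections,
   composition of functor data is then associative and unital up to conversion,
   so that, as on paper, no associators or unitors are needed between
   composites of natural transformations. *)
Set Primitive Projections.
Record FunctorData (C D : Category) := {
  fobj :> C -> D;
  fmap : forall x y : C, hom x y -> hom (fobj x) (fobj y)
}.
Unset Primitive Projections.

Arguments fmap {_ _} _ {_ _} _.

Class IsFunctor (C D : Category) (F : FunctorData C D) : Prop := {
  fmap_id : forall x : C, fmap F (idm x) = idm (F x);
  fmap_comp : forall (x y z : C) (g : hom y z) (f : hom x y),
    fmap F (comp g f) = comp (fmap F g) (fmap F f)
}.

Definition functor_id (C : Category) : FunctorData C C :=
  {| fobj := fun x => x; fmap := fun _ _ f => f |}.

Definition functor_comp (C D E : Category)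
    (F : FunctorData D E) (G : FunctorData C D) : FunctorData C E :=
  {| fobj := fun x => F (G x); fmap := fun _ _ f => fmap F (fmap G f) |}.

Arguments functor_id {_}.

Notation "F ∘ G" := (functor_comp F G)
  (at level 40, left associativity) : cat_scope.

#[export] Instance functor_id_isFunctor (C : Category) :
  IsFunctor (@functor_id C).
Proof. split; reflexivity. Qed.

#[export] Instance functor_comp_isFunctor (C D E : Category)
    (F : FunctorData D E) (G : FunctorData C D) :
  IsFunctor F -> IsFunctor G -> IsFunctor (F ∘ G).
Proof.
intros HF HG; split; intros; simpl.
- rewrite (fmap_id (F := G)). apply fmap_id.
- rewrite (fmap_comp (F := G)). apply fmap_comp.
Qed.

Record NatTrans (C D : Category) (F G : FunctorData C D) := {
  component :> forall x : C, hom (F x) (G x);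
  naturality : forall (x y : C) (f : hom x y),
    comp (component y) (fmap F f) = comp (fmap G f) (component x)
}.

Notation "F ⇒ G" := (NatTrans F G) (at level 70, no associativity) : cat_scope.

Definition nt_eq (C D : Category) (F G : FunctorData C D) (a b : F ⇒ G) : Prop :=
  forall x : C, a x = b x.

Notation "a ≡ b" := (nt_eq a b) (at level 70, no associativity) : cat_scope.

Program Definition nt_id (C D : Category) (F : FunctorData C D) : F ⇒ F :=
  {| component := fun x => idm (F x) |}.
Next Obligation. intros; simpl. rewrite id_left, id_right. reflexivity. Qed.

Program Definition vcomp (C D : Category) (F G K : FunctorData C D)
    (b : G ⇒ K) (a : F ⇒ G) : F ⇒ K :=
  {| component := fun x => comp (b x) (a x) |}.
Next Obligation.
intros; simpl. rewrite <- comp_assoc, naturality, comp_assoc, naturality, comp_assoc.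
reflexivity.
Qed.

Program Definition whisker_left (C D E : Category)
    (K : FunctorData D E) {HK : IsFunctor K} (F G : FunctorData C D)
    (a : F ⇒ G) : K ∘ F ⇒ K ∘ G :=
  {| component := fun x => fmap K (a x) |}.
Next Obligation. intros; simpl. rewrite <- !fmap_comp, naturality. reflexivity. Qed.

Program Definition whisker_right (C D E : Category)
    (F G : FunctorData D E) (a : F ⇒ G) (K : FunctorData C D) :
    F ∘ K ⇒ G ∘ K :=
  {| component := fun x => a (K x) |}.
Next Obligation. intros; simpl. apply naturality. Qed.

Arguments whisker_left {_ _ _} K {_ _ _} a.

Notation "b · a" := (vcomp b a) (at level 40, left associativity) : cat_scope.
(* [K ◁ a] is Ka and [a ▷ K] is aK in juxtaposition notation. *)
Notation "K ◁ a" := (whisker_left K a)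
  (at level 35, right associativity) : cat_scope.
Notation "a ▷ K" := (whisker_right a K)
  (at level 34, left associativity) : cat_scope.

Definition hcomp (C D E : Category) (F F' : FunctorData D E)
    (G G' : FunctorData C D) {HF : IsFunctor F}
    (a : F ⇒ F') (b : G ⇒ G') : F ∘ G ⇒ F' ∘ G' :=
  (a ▷ G') · (F ◁ b).

Notation "a ⊚ b" := (hcomp a b) (at level 35, no associativity) : cat_scope.

Record Monad (A : Category) (H : FunctorData A A) {HF : IsFunctor H} := {
  mult : H ∘ H ⇒ H;
  munit : functor_id ⇒ H;
  mult_assoc : mult · (mult ▷ H) ≡ mult · (H ◁ mult);
  mult_unit_left : mult · (munit ▷ H) ≡ nt_id H;
  mult_unit_right : mult · (H ◁ munit) ≡ nt_id H
}.

Record Comonad (A : Category) (H : FunctorData A A) {HF : IsFunctor H} := {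
  comult : H ⇒ H ∘ H;
  counit : H ⇒ functor_id;
  comult_coassoc : (comult ▷ H) · comult ≡ (H ◁ comult) · comult;
  comult_counit_left : (counit ▷ H) · comult ≡ nt_id H;
  comult_counit_right : (H ◁ counit) · comult ≡ nt_id H
}.

Arguments Monad {A} H {HF}.
Arguments Comonad {A} H {HF}.

Section WeakBraidedBimonads.

Variables (A : Category) (H : FunctorData A A).
Context {HF : IsFunctor H}.

Definition YangBaxter (t : H ∘ H ⇒ H ∘ H) : Prop :=
  (H ◁ t) · (t ▷ H) · (H ◁ t) ≡ (t ▷ H) · (H ◁ t) · (t ▷ H).

Record IsWeakYBPair (τ τ' : H ∘ H ⇒ H ∘ H) : Prop := {
  wyb_regular : τ · τ' · τ ≡ τ;
  wyb_regular' : τ' · τ · τ' ≡ τ';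
  wyb_commute : τ · τ' ≡ τ' · τ;
  wyb_YB : YangBaxter τ;
  wyb_YB' : YangBaxter τ';
  wyb_nabla_right :
    (τ ▷ H) · (H ◁ (τ · τ')) ≡ (H ◁ (τ · τ')) · (τ ▷ H);
  wyb_nabla_left :
    (H ◁ τ) · ((τ · τ') ▷ H) ≡ ((τ · τ') ▷ H) · (H ◁ τ);
  wyb_nabla_right' :
    (τ' ▷ H) · (H ◁ (τ · τ')) ≡ (H ◁ (τ · τ')) · (τ' ▷ H);
  wyb_nabla_left' :
    (H ◁ τ') · ((τ · τ') ▷ H) ≡ ((τ · τ') ▷ H) · (H ◁ τ')
}.

Variables (M : Monad H) (N : Comonad H).
Local Notation m := (mult M).
Local Notation e := (munit M).
Local Notation δ := (comult N).
Local Notation ε := (counit N).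

Record IsWeakBraidedBimonad (τ τ' : H ∘ H ⇒ H ∘ H) : Prop := {
  wbb_YB : IsWeakYBPair τ τ';
  wbb_mult_nabla : m · (τ · τ') ≡ m;
  wbb_nabla_comult : (τ · τ') · δ ≡ δ;
  wbb_nabla_unit_right : (τ · τ') · (H ◁ e) ≡ τ · (e ▷ H);
  wbb_counit_right_nabla : (H ◁ ε) · (τ · τ') ≡ (ε ▷ H) · τ;
  wbb_nabla_unit_left : (τ · τ') · (e ▷ H) ≡ τ · (H ◁ e);
  wbb_counit_left_nabla : (ε ▷ H) · (τ · τ') ≡ (H ◁ ε) · τ;
  wbb_comult_left : (δ ▷ H) · τ ≡ (H ◁ τ) · (τ ▷ H) · (H ◁ δ);
  wbb_mult_left : τ · (m ▷ H) ≡ (H ◁ m) · (τ ▷ H) · (H ◁ τ);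
  wbb_comult_right : (H ◁ δ) · τ ≡ (τ ▷ H) · (H ◁ τ) · (δ ▷ H);
  wbb_mult_right : τ · (H ◁ m) ≡ (m ▷ H) · (H ◁ τ) · (τ ▷ H);
  wbb_comult_mult : δ · m ≡ (m ⊚ m) · (H ◁ (τ ▷ H)) · (δ ⊚ δ);
  wbb_counit_mult :
    (ε ⊚ ε) · (m ⊚ m) · (H ◁ (δ ▷ H)) ≡ ε · m · (m ▷ H);
  wbb_counit_mult' :
    ε · m · (m ▷ H)
    ≡ (ε ⊚ ε) · (m ⊚ m) · (H ◁ (τ' ▷ H)) · (H ◁ (δ ▷ H));
  wbb_comult_unit :
    (H ◁ (m ▷ H)) · (δ ⊚ δ) · (e ⊚ e) ≡ (δ ▷ H) · δ · e;
  wbb_comult_unit' :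
    (δ ▷ H) · δ · e
    ≡ (H ◁ (m ▷ H)) · (H ◁ (τ' ▷ H)) · (δ ⊚ δ) · (e ⊚ e)
}.

Definition xi (ω : H ∘ H ⇒ H ∘ H) : H ⇒ H := (ε ▷ H) · ω · (e ▷ H).

Record IsWeakMonadComonadEntwining (ω : H ∘ H ⇒ H ∘ H) : Prop := {
  wmc_mult : ω · (m ▷ H) ≡ (H ◁ m) · (ω ▷ H) · (H ◁ ω);
  wmc_comult : (δ ▷ H) · ω ≡ (H ◁ ω) · (ω ▷ H) · (H ◁ δ);
  wmc_unit : ω · (e ▷ H) ≡ (H ◁ xi ω) · δ;
  wmc_counit : (ε ▷ H) · ω ≡ m · (H ◁ xi ω)
}.

Definition IsCompatibleMonadComonad (ω : H ∘ H ⇒ H ∘ H) : Prop :=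
  δ · m ≡ (H ◁ m) · (ω ▷ H) · (H ◁ δ).

Definition xi_bar (ω : H ∘ H ⇒ H ∘ H) : H ⇒ H := (H ◁ ε) · ω · (H ◁ e).

Record IsWeakComonadMonadEntwining (ω : H ∘ H ⇒ H ∘ H) : Prop := {
  wcm_mult : ω · (H ◁ m) ≡ (m ▷ H) · (H ◁ ω) · (ω ▷ H);
  wcm_comult : (H ◁ δ) · ω ≡ (ω ▷ H) · (H ◁ ω) · (δ ▷ H);
  wcm_unit : ω · (H ◁ e) ≡ (xi_bar ω ▷ H) · δ;
  wcm_counit : (H ◁ ε) · ω ≡ m · (xi_bar ω ▷ H)
}.

Definition IsCompatibleComonadMonad (ω : H ∘ H ⇒ H ∘ H) : Prop :=
  δ · m ≡ (m ▷ H) · (H ◁ ω) · (δ ▷ H).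

End WeakBraidedBimonads.

(* Main.v *)
(* The key identity is Hτ·δH·eH = τ'H·Hδ·He, which turns axiom (7) into
   Hσ·δ·e = Hδ·δ·e for σ := ω·eH.  Together with the compatibility of σ with m
   and τ this gives Hσ·σ = Hδ·σ, and expanding b as 1·b in Hσ·δ then yields the
   unit law.

   The comultiplication and counit laws for ω are the multiplication and unit
   laws in the opposite category, since the axioms are self-dual and the dual
   of ω is again ω.  The axioms are also stable under mirroring diagrams from
   left to right, which exchanges ω and its barred version: mirroring is
   realised by replacing H on A with the functor F ↦ FH on the category of
   endofunctors of A, and the mirrored laws are read off at F = 1. *)

Require Import Defs.
From Stdlib Require Import Setoid Morphisms.
From Stdlib Require Import FunctionalExtensionality ProofIrrelevance.
Local Open Scope cat_scope.
Set Implicit Arguments.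
Unset Strict Implicit.

(** * Calculating with components of natural transformations *)

(** The generic k gives every composite a leftmost factor, so that postcomposed equations also match
    at the top of a diagram. *)
Lemma hom_ext (A : Category) (x y : A) (f g : hom x y) :
  (forall w (k : hom y w), comp k f = comp k g) -> f = g.
Proof. intros E. rewrite <- (id_left f), <- (id_left g). apply E. Qed.

(* Equations are postcomposed with an arbitrary k, so that they rewrite any
   contiguous part of a left-associated composite. *)
Lemma comp_cells (C D : Category) (F G : FunctorData C D) (a b : F ⇒ G) :
  a ≡ b -> forall x w (k : hom (G x) w), comp k (a x) = comp k (b x).
Proof. intros E x w k; rewrite (E x); reflexivity. Qed.

Lemma comp_naturality (C D E : Category) (F G : FunctorData C D) (a : F ⇒ G)
    (K : FunctorData D E) {HK : IsFunctor K}
    (x y : C) (f : hom x y) (w : E) (k : hom (K (G y)) w) :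
  comp (comp k (fmap K (a y))) (fmap K (fmap F f)) =
  comp (comp k (fmap K (fmap G f))) (fmap K (a x)).
Proof.
rewrite <- !comp_assoc, <- !fmap_comp, naturality; reflexivity.
Qed.

Lemma whisker_left_cells (C D E : Category) (K : FunctorData D E)
    {HK : IsFunctor K} (F G : FunctorData C D) (a b : F ⇒ G) :
  a ≡ b -> K ◁ a ≡ K ◁ b.
Proof. intros Eab x; simpl; rewrite (Eab x); reflexivity. Qed.

Lemma whisker_right_cells (C D E : Category) (F G : FunctorData D E)
    (a b : F ⇒ G) (K : FunctorData C D) :
  a ≡ b -> a ▷ K ≡ b ▷ K.
Proof. intros Eab x; apply Eab. Qed.

Lemma cells_trans (C D : Category) (F G : FunctorData C D) (b a c : F ⇒ G) :
  a ≡ b -> b ≡ c -> a ≡ c.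
Proof. intros E E' x; rewrite (E x); apply E'. Qed.

Lemma cells_sym (C D : Category) (F G : FunctorData C D) (a b : F ⇒ G) :
  a ≡ b -> b ≡ a.
Proof. intros E x; symmetry; apply E. Qed.

(** The laws of [endo_category] are Leibniz equalities of natural transformations, not just
    pointwise ones. *)
Lemma nt_ext (C D : Category) (F G : FunctorData C D) (a b : F ⇒ G) :
  a ≡ b -> a = b.
Proof.
destruct a as [a Ha], b as [b Hb]; intro E.
assert (a = b) by exact (functional_extensionality_dep a b E).
subst b; f_equal; apply proof_irrelevance.
Qed.

Ltac flatten_in E :=
  cbn [component vcomp whisker_left whisker_right nt_id hcomp functor_comp
       functor_id fobj fmap] in E;
  repeat setoid_rewrite fmap_comp in E; repeat setoid_rewrite fmap_id in E;
  repeat setoid_rewrite id_right in E;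
  repeat setoid_rewrite comp_assoc in E;
  repeat setoid_rewrite id_right in E.

Ltac flatten :=
  cbn [component vcomp whisker_left whisker_right nt_id hcomp functor_comp
       functor_id fobj fmap];
  rewrite ?fmap_comp, ?fmap_id, ?comp_assoc, ?id_right.

Ltac cells :=
  let x := fresh "x" in let w := fresh "w" in let k := fresh "k" in
  intro x; apply hom_ext; intros w k; flatten.

Ltac rewrite_cells E :=
  let E' := fresh in
  pose proof (comp_cells E) as E'; flatten_in E';
  rewrite E'; clear E'.

(** Level n puts [E] under n copies of H on the left; whiskering on the right is mere instantiation
    of the object. *)
Ltac rewrite_level n E :=
  lazymatch n with
  | 0 => rewrite_cells E
  | S ?p => match goal with H : FunctorData ?A ?A |- _ =>
      rewrite_level p (whisker_left_cells (K := H) E) end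
  end.

Ltac rw E :=
  first [rewrite_level 0 E | rewrite_level 1 E | rewrite_level 2 E].

Ltac rwl E := rw (cells_sym E).

Ltac slide_at K a :=
  let E := fresh in
  pose proof (comp_naturality a (K := K)) as E;
  cbn [functor_comp functor_id fobj fmap] in E;
  rewrite !E; clear E.

(* Interchange: cells on strands further to the left are moved to the bottom
   of the diagram, that is, to the right of the composite. *)
Ltac slides :=
  repeat match goal with
  H : FunctorData ?A ?A |- context [component ?a _] =>
    first [slide_at (@functor_id A) a | slide_at H a
          | slide_at (H ∘ H) a | slide_at (H ∘ H ∘ H) a]
  end.

Ltac step T := apply (cells_trans (b := T)).

Ltac by_cells E :=
  apply hom_ext; intros; flatten;
  first [ rw E; slides; reflexivity
        | rwl E; slides; reflexivity
        | slides; rw E; slides; reflexivity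
        | slides; rwl E; slides; reflexivity ].

(** * The braiding against comultiplication and unit *)

Section BraidingComultiplication.
Variables (A : Category) (H : FunctorData A A).
Context {HF : IsFunctor H}.
Variables (M : Monad H) (N : Comonad H) (τ τ' : H ∘ H ⇒ H ∘ H).
Hypothesis W : IsWeakBraidedBimonad M N τ τ'.
Local Notation m := (mult M).
Local Notation e := (munit M).
Local Notation δ := (comult N).

Let YB := wbb_YB W.

(** With ∇ = τ·τ', both sides equal ∇H·Hδ·∇: Hδ·∇ absorbs ∇H because Hδ·τ = τH·Hτ·δH, and ∇H·Hδ
    absorbs ∇ because τH·Hδ = Hτ'·δH·τ. *)
Lemma comult_nabla :
  (H ◁ δ) · (τ · τ') ≡ ((τ · τ') ▷ H) · (H ◁ δ).
Proof.
assert (E : (τ ▷ H) · (H ◁ δ)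
    ≡ (H ◁ τ') · (H ◁ τ) · (τ ▷ H) · (H ◁ δ)).
{ cells. rwl (wyb_commute YB). rwl (wyb_nabla_right YB).
  rw (wbb_nabla_comult W). reflexivity. }
step (((τ · τ') ▷ H) · (H ◁ δ) · (τ · τ')).
{ cells. rw (wbb_comult_right W). rw (wbb_comult_right W).
  rw (wyb_regular YB). reflexivity. }
assert (F : (τ ▷ H) · (H ◁ δ) · (τ · τ') ≡ (τ ▷ H) · (H ◁ δ)).
{ step ((H ◁ τ') · (δ ▷ H) · (τ · (τ · τ'))).
  { cells. rw (wbb_comult_left W). rw E. reflexivity. }
  step ((H ◁ τ') · (δ ▷ H) · τ).
  { cells. rw (wyb_commute YB). rw (wyb_regular YB). reflexivity. }
  cells. rw (wbb_comult_left W). rwl E. reflexivity. }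
step ((τ' ▷ H) · (τ ▷ H) · (H ◁ δ) · (τ · τ')).
{ cells. rw (whisker_right_cells H (wyb_commute YB)). reflexivity. }
step ((τ' ▷ H) · (τ ▷ H) · (H ◁ δ)).
{ cells. rw F. reflexivity. }
cells. rwl (wyb_commute YB). reflexivity.
Qed.

(** The left side absorbs ∇H, since ∇H passes Hτ and ∇·δ = δ. Then τH·Hτ·δH·eH = Hδ·τ·eH = Hδ·∇·He,
    and [comult_nabla] brings ∇ up to τ', which absorbs it. *)
Lemma braid_comult_unit :
  (H ◁ τ) · (δ ▷ H) · (e ▷ H) ≡ (τ' ▷ H) · (H ◁ δ) · (H ◁ e).
Proof.
step ((τ' ▷ H) · (τ ▷ H) · (H ◁ τ) · (δ ▷ H) · (e ▷ H)).
{ cells. rwl (wyb_commute YB). rwl (wyb_nabla_left YB).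
  rw (wbb_nabla_comult W). reflexivity. }
step ((τ' ▷ H) · (H ◁ δ) · (τ · τ') · (H ◁ e)).
{ cells. rwl (wbb_comult_right W). rw (wbb_nabla_unit_right W). reflexivity. }
step ((τ' ▷ H) · (τ ▷ H) · (τ' ▷ H) · (H ◁ δ) · (H ◁ e)).
{ cells. rw comult_nabla. reflexivity. }
cells. rw (wyb_regular' YB). reflexivity.
Qed.

Lemma comult_unit_insert :
  (H ◁ ((m ▷ H) · (H ◁ τ) · (δ ▷ H) · (e ▷ H))) · δ · e ≡ (H ◁ δ) · δ · e.
Proof.
step ((H ◁ (m ▷ H)) · (H ◁ (τ' ▷ H)) · (δ ⊚ δ) · (e ⊚ e)).
{ cells. rw braid_comult_unit. slides. reflexivity. }
cells. rwl (wbb_comult_unit' W). rw (comult_coassoc N). reflexivity.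
Qed.

End BraidingComultiplication.

(** * Duality *)

(** Only vertical composition is reversed; the left-to-right order of strands is kept. *)
Definition opposite (C : Category) : Category :=
  {| obj := C; hom := fun x y => hom y x; idm := fun x => idm x;
     comp := fun x y z g f => comp f g;
     id_left := fun x y f => id_right f;
     id_right := fun x y f => id_left f;
     comp_assoc := fun x y z w h g f => eq_sym (comp_assoc f g h) |}.

Definition opposite_functor (C D : Category) (F : FunctorData C D) :
    FunctorData (opposite C) (opposite D) :=
  {| fobj := fun x : opposite C => F x : opposite D;
     fmap := fun (x y : opposite C) (f : hom x y) =>
       (fmap F (f : @hom C y x) : @hom (opposite D) (F x) (F y)) |}.

#[local] Instance opposite_functor_isFunctor (C D : Category)
    (F : FunctorData C D) {HF : IsFunctor F} : IsFunctor (opposite_functor F).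
Proof.
split; intros; simpl.
- apply (fmap_id (F := F)).
- apply (fmap_comp (F := F)).
Qed.

Definition opposite_nt (C D : Category) (F G : FunctorData C D) (a : F ⇒ G) :
    opposite_functor G ⇒ opposite_functor F :=
  @Build_NatTrans (opposite C) (opposite D) (opposite_functor G)
    (opposite_functor F) a (fun x y f => eq_sym (naturality a f)).

Section Opposite.
Variables (A : Category) (H : FunctorData A A).
Context {HF : IsFunctor H}.
Let H' := opposite_functor H.

Definition opposite_monad (N : Comonad H) : Monad H'.
Proof.
refine {| mult := opposite_nt (comult N) : H' ∘ H' ⇒ H';
          munit := opposite_nt (counit N) : functor_id ⇒ H' |}.
- exact (comult_coassoc N).
- exact (comult_counit_left N).
- exact (comult_counit_right N).
Defined.

Definition opposite_comonad (M : Monad H) : Comonad H'.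
Proof.
refine {| comult := opposite_nt (mult M) : H' ⇒ H' ∘ H';
          counit := opposite_nt (munit M) : H' ⇒ functor_id |}.
- exact (mult_assoc M).
- exact (mult_unit_left M).
- exact (mult_unit_right M).
Defined.

Definition opposite_cell (t : H ∘ H ⇒ H ∘ H) : H' ∘ H' ⇒ H' ∘ H' :=
  opposite_nt t.

End Opposite.

Section OppositeBimonad.
Variables (A : Category) (H : FunctorData A A).
Context {HF : IsFunctor H}.

Lemma opposite_YB (τ τ' : H ∘ H ⇒ H ∘ H) :
  IsWeakYBPair τ τ' -> IsWeakYBPair (opposite_cell τ) (opposite_cell τ').
Proof.
intros Y.
(* Reversal turns τ·τ' into τ'·τ; [C] restores the order. *)
assert (C : forall x, comp (τ' x) (τ x) = comp (τ x) (τ' x)).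
{ intro x; symmetry; apply (wyb_commute Y). }
cbn in C; split; intro x; change (obj A) in x; cbn.
- by_cells (wyb_regular Y).
- by_cells (wyb_regular' Y).
- apply C.
- by_cells (wyb_YB Y).
- by_cells (wyb_YB' Y).
- rewrite C. by_cells (wyb_nabla_right Y).
- rewrite C. by_cells (wyb_nabla_left Y).
- rewrite C. by_cells (wyb_nabla_right' Y).
- rewrite C. by_cells (wyb_nabla_left' Y).
Qed.

Variables (M : Monad H) (N : Comonad H) (τ τ' : H ∘ H ⇒ H ∘ H).
Hypothesis W : IsWeakBraidedBimonad M N τ τ'.

Lemma opposite_bimonad :
  IsWeakBraidedBimonad (opposite_monad N) (opposite_comonad M)
    (opposite_cell τ) (opposite_cell τ').
Proof.
assert (C : forall x, comp (τ' x) (τ x) = comp (τ x) (τ' x)).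
{ intro x; symmetry; apply (wyb_commute (wbb_YB W)). }
cbn in C; split; [apply opposite_YB, (wbb_YB W)|..];
  intro x; change (obj A) in x; cbn; rewrite ?C.
- by_cells (wbb_nabla_comult W).
- by_cells (wbb_mult_nabla W).
- by_cells (wbb_counit_right_nabla W).
- by_cells (wbb_nabla_unit_right W).
- by_cells (wbb_counit_left_nabla W).
- by_cells (wbb_nabla_unit_left W).
- by_cells (wbb_mult_left W).
- by_cells (wbb_comult_left W).
- by_cells (wbb_mult_right W).
- by_cells (wbb_comult_right W).
- by_cells (wbb_comult_mult W).
- by_cells (wbb_comult_unit W).
- by_cells (wbb_comult_unit' W).
- by_cells (wbb_counit_mult W).
- by_cells (wbb_counit_mult' W).
Qed.

End OppositeBimonad.

(** * The entwining ω *)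

Section Entwining.
Variables (A : Category) (H : FunctorData A A).
Context {HF : IsFunctor H}.
Variables (M : Monad H) (N : Comonad H) (τ τ' : H ∘ H ⇒ H ∘ H).
Hypothesis W : IsWeakBraidedBimonad M N τ τ'.
Local Notation m := (mult M).
Local Notation e := (munit M).
Local Notation δ := (comult N).
Local Notation ε := (counit N).

Let YB := wbb_YB W.

(** The dual of [comult_nabla]. *)
Lemma nabla_mult : (τ · τ') · (H ◁ m) ≡ (H ◁ m) · ((τ · τ') ▷ H).
Proof.
step ((τ' · τ) · (H ◁ m)).
{ cells. rw (wyb_commute YB). reflexivity. }
step ((H ◁ m) · ((τ' · τ) ▷ H)).
- intro x. generalize (comult_nabla (opposite_bimonad W) x).
  cbn. intro E. exact E.
- cells. rw (wyb_commute YB). reflexivity.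
Qed.

(** ω is fixed only up to ≡, so that the results also apply to its opposite and its mirror image. *)
Variables (ω : H ∘ H ⇒ H ∘ H) (σ : H ⇒ H ∘ H).
Hypothesis ω_def : ω ≡ (m ▷ H) · (H ◁ τ) · (δ ▷ H).

Lemma omega_compatible : δ · m ≡ (H ◁ m) · (ω ▷ H) · (H ◁ δ).
Proof. cells. rw ω_def. rw (wbb_comult_mult W). slides. reflexivity. Qed.

Lemma omega_mult_right : ω · (H ◁ m) ≡ (m ▷ H) · (H ◁ τ) · (ω ▷ H).
Proof.
cells. rw ω_def. rw ω_def. slides. rw (wbb_mult_right W).
slides. rwl (mult_assoc M). slides. reflexivity.
Qed.

(** Compatibility opens the δ·m inside ω·mH, [wbb_mult_left] splits the τ above it, and
    [omega_mult_right] refolds the upper ω. *)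
Lemma omega_mult_left : ω · (m ▷ H) ≡ (H ◁ m) · (ω ▷ H) · (H ◁ ω).
Proof.
step ((m ▷ H) · (H ◁ τ) · (H ◁ m ▷ H) · (ω ▷ H ▷ H) · (H ◁ δ ▷ H)).
{ cells. rw ω_def. rw omega_compatible. slides. reflexivity. }
step ((H ◁ m) · ((m ▷ H) · (H ◁ τ) · (ω ▷ H)) ▷ H
  · (H ◁ H ◁ τ) · (H ◁ δ ▷ H)).
{ cells. rw (wbb_mult_left W). slides. reflexivity. }
cells. rwl omega_mult_right. rewrite_level 1 ω_def. slides. reflexivity.
Qed.

Hypothesis σ_def : σ ≡ ω · (e ▷ H).

Lemma sigma_def : σ ≡ (m ▷ H) · (H ◁ τ) · (δ ▷ H) · (e ▷ H).
Proof. cells. rw σ_def. rw ω_def. reflexivity. Qed.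

Lemma sigma_mult : σ · m ≡ (m ▷ H) · (H ◁ τ) · (σ ▷ H).
Proof.
cells. rw σ_def. rw σ_def. slides. rw omega_mult_right. slides. reflexivity.
Qed.

(** The key identity gives σ = mH·τ'H·Hδ·He, where δ·e lies to the right of the incoming strand, so
    ∇ has to pass only m and τ'. *)
Lemma nabla_sigma : ((τ · τ') ▷ H) · (H ◁ σ) ≡ (H ◁ σ) · (τ · τ').
Proof.
assert (E : σ ≡ (m ▷ H) · (τ' ▷ H) · (H ◁ δ) · (H ◁ e)).
{ cells. rw sigma_def. rw (braid_comult_unit W). reflexivity. }
cells. rw E. rw E. rw nabla_mult. rwl (wyb_nabla_left' YB). slides.
reflexivity.
Qed.

(** From right to left: Yang-Baxter sends one τ to the bottom, and the rest is ∇H·Hσ because τ·eH =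
    ∇·He. [nabla_sigma] moves ∇ down to that τ, which absorbs it. *)
Lemma sigma_braid : (H ◁ σ) · τ ≡ (τ ▷ H) · (H ◁ τ) · (σ ▷ H).
Proof.
apply cells_sym.
step ((τ ▷ H) · (m ▷ H ▷ H) · (H ◁ ((H ◁ τ) · (τ ▷ H)))
  · (δ ▷ H ▷ H) · (e ▷ H ▷ H)).
{ cells. rw sigma_def. slides. reflexivity. }
step ((H ◁ m ▷ H) · (τ ▷ H ▷ H) · (H ◁ (τ ▷ H · H ◁ τ · τ ▷ H))
  · (δ ▷ H ▷ H) · (e ▷ H ▷ H)).
{ cells. rw (wbb_mult_left W). slides. reflexivity. }
step ((H ◁ m ▷ H) · (τ ▷ H ▷ H) · (H ◁ (H ◁ τ · τ ▷ H · H ◁ τ))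
  · (δ ▷ H ▷ H) · (e ▷ H ▷ H)).
{ cells. rwl (wyb_YB YB). slides. reflexivity. }
step ((H ◁ m ▷ H) · (H ◁ H ◁ τ) · ((H ◁ δ) · τ · (e ▷ H)) ▷ H · τ).
{ cells. rw (wbb_comult_right W). slides. reflexivity. }
step ((H ◁ m ▷ H) · (H ◁ H ◁ τ) · ((τ · τ') ▷ H · (H ◁ δ) · (H ◁ e)) ▷ H
  · τ).
{ cells. rwl (wbb_nabla_unit_right W). rw (comult_nabla W). reflexivity. }
step (((τ · τ') ▷ H) · (H ◁ m ▷ H) · (H ◁ H ◁ τ)
  · (H ◁ δ ▷ H) · (H ◁ e ▷ H) · τ).
{ cells. rw nabla_mult. slides. reflexivity. }
step ((H ◁ σ) · (τ · τ' · τ)).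
{ cells. rwl sigma_def. rw nabla_sigma. reflexivity. }
cells. rw (wyb_regular YB). reflexivity.
Qed.

(** With the lower σ expanded, [sigma_braid] carries the upper one down onto δ·e, where
    [comult_unit_insert] replaces it by δ; this δ then travels back up through τ. *)
Lemma sigma_sigma : (H ◁ σ) · σ ≡ (H ◁ δ) · σ.
Proof.
step ((m ▷ H ▷ H) · (H ◁ ((H ◁ σ) · τ)) · (δ ▷ H) · (e ▷ H)).
{ cells. rewrite_level 0 sigma_def. slides. reflexivity. }
step ((m ▷ H ▷ H) · (H ◁ ((τ ▷ H) · (H ◁ τ))) · ((H ◁ σ) · δ · e) ▷ H).
{ cells. rw sigma_braid. slides. reflexivity. }
step ((m ▷ H ▷ H) · (H ◁ ((τ ▷ H) · (H ◁ τ) · (δ ▷ H))) · (δ · e) ▷ H).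
{ cells. rw sigma_def. rw (comult_unit_insert W). slides. reflexivity. }
cells. rwl (wbb_comult_right W). rw sigma_def. slides. reflexivity.
Qed.

(** The comultiplication law is a premise because it comes only later, as the dual of
    [omega_mult_left]. *)
Lemma omega_unit :
  (δ ▷ H) · ω ≡ (H ◁ ω) · (ω ▷ H) · (H ◁ δ) ->
  ω · (e ▷ H) ≡ (H ◁ xi M N ω) · δ.
Proof.
intro D. apply cells_sym.
step ((H ◁ ε ▷ H) · (H ◁ σ) · δ).
{ unfold xi. cells. rw σ_def. reflexivity. }
step ((H ◁ ε ▷ H) · (H ◁ (σ · m)) · (σ ▷ H) · δ).
(* Insert m·eH = 1 below δ and expand δ·m by compatibility. *)
{ step ((H ◁ ε ▷ H) · (H ◁ σ) · δ · m · (e ▷ H)).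
  - cells. rw (mult_unit_left M). reflexivity.
  - cells. rw omega_compatible. rw (whisker_right_cells H σ_def). slides.
    reflexivity. }
step ((H ◁ ε ▷ H) · (H ◁ ω) · (σ ▷ H) · δ).
{ step ((H ◁ ε ▷ H) · (H ◁ (m ▷ H · H ◁ τ)) · ((H ◁ σ) · σ) ▷ H · δ).
  - cells. rw sigma_mult. reflexivity.
  - cells. rw sigma_sigma. rw ω_def. reflexivity. }
step ((H ◁ ε ▷ H) · (H ◁ ω) · (ω ▷ H) · (H ◁ δ) · (e ▷ H)).
{ cells. rw σ_def. slides. reflexivity. }
cells. rwl D. rw (comult_counit_right N). reflexivity.
Qed.

End Entwining.

(** * The dual laws and the monad-comonad entwining *)

Section DualLaws.
Variables (A : Category) (H : FunctorData A A).
Context {HF : IsFunctor H}.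
Variables (M : Monad H) (N : Comonad H) (τ τ' : H ∘ H ⇒ H ∘ H).
Hypothesis W : IsWeakBraidedBimonad M N τ τ'.
Local Notation H' := (opposite_functor H).
Local Notation M' := (opposite_monad N).
Local Notation N' := (opposite_comonad M).
Local Notation m := (mult M).
Local Notation e := (munit M).
Local Notation δ := (comult N).
Local Notation ε := (counit N).
Variable (ω : H ∘ H ⇒ H ∘ H).
Hypothesis ω_def : ω ≡ (m ▷ H) · (H ◁ τ) · (δ ▷ H).

Lemma opposite_omega :
  opposite_cell ω
  ≡ (mult M' ▷ H') · (H' ◁ opposite_cell τ) · (comult N' ▷ H').
Proof. intro x; change (obj A) in x; cbn. by_cells ω_def. Qed.

Lemma omega_comult : (δ ▷ H) · ω ≡ (H ◁ ω) · (ω ▷ H) · (H ◁ δ).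
Proof.
intro x. generalize (omega_mult_left (opposite_bimonad W) opposite_omega x).
cbn. intro E. rewrite E. apply comp_assoc.
Qed.

Lemma omega_counit : (ε ▷ H) · ω ≡ m · (H ◁ xi M N ω).
Proof.
pose (ω' := opposite_cell ω : H' ∘ H' ⇒ H' ∘ H').
(* The premise of [omega_unit] for the opposite is the multiplication law of ω. *)
assert (D : (comult N' ▷ H') · ω'
    ≡ (H' ◁ ω') · (ω' ▷ H') · (H' ◁ comult N')).
{ intro y; change (obj A) in y; cbn. by_cells (omega_mult_left W ω_def). }
intro x.
generalize (omega_unit (opposite_bimonad W) opposite_omega
  (σ := ω' · (munit M' ▷ H')) (fun x => eq_refl) D x).
(* The dual of ξ is ξ, bracketed the other way. *)
cbn. intro F. rewrite comp_assoc in F. exact F.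
Qed.

Lemma omega_entwining :
  IsWeakMonadComonadEntwining M N ω /\ IsCompatibleMonadComonad M N ω.
Proof.
split; [split|].
- exact (omega_mult_left W ω_def).
- exact omega_comult.
- exact (omega_unit W ω_def (fun x => eq_refl) omega_comult).
- exact omega_counit.
- exact (omega_compatible W ω_def).
Qed.

End DualLaws.

(** * Mirror images *)

(** The laws are bundled because a mirrored cell has components [F ◁ a], which need F to be a
    functor. *)
Record Endofunctor (C : Category) := {
  endo :> FunctorData C C;
  endo_isFunctor : IsFunctor endo
}.
#[local] Existing Instance endo_isFunctor.

Definition endo_category (C : Category) : Category.
Proof.
refine {| obj := Endofunctor C; hom := fun F G => F ⇒ G;
  idm := fun F => nt_id F; comp := fun F G K b a => b · a |};
intros; apply nt_ext; intro; cbn.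
- apply id_left.
- apply id_right.
- apply comp_assoc.
Defined.

Section Mirror.
Variables (A : Category) (H : FunctorData A A).
Context {HF : IsFunctor H}.

(** Whiskering a mirrored cell by [precompose] on the left whiskers the original by H on the right,
    and conversely. *)
Definition precompose : FunctorData (endo_category A) (endo_category A) :=
  {| fobj := fun F : endo_category A =>
       {| endo := F ∘ H; endo_isFunctor := _ |} : endo_category A;
     fmap := fun (F G : endo_category A) (a : hom F G) => (a : F ⇒ G) ▷ H |}.

#[local] Instance precompose_isFunctor : IsFunctor precompose.
Proof. split; intros; apply nt_ext; intro; reflexivity. Qed.

(** Naturality of [F ◁ a] in F is naturality of b at the components of a. *)
Ltac precompose_with a :=
  let F := fresh in let G := fresh in let b := fresh in let x := fresh in
  unshelve refine (Build_NatTrans _);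
  [ exact (fun F : Endofunctor A => F ◁ a)
  | intros F G b; apply nt_ext; intro x;
    exact (eq_sym
      (naturality (b : (F : Endofunctor A) ⇒ (G : Endofunctor A)) (a x))) ].

Definition precompose_mult (a : H ∘ H ⇒ H) :
    precompose ∘ precompose ⇒ precompose.
Proof. precompose_with a. Defined.

Definition precompose_comult (a : H ⇒ H ∘ H) :
    precompose ⇒ precompose ∘ precompose.
Proof. precompose_with a. Defined.

Definition precompose_unit (a : functor_id ⇒ H) :
    functor_id ⇒ precompose.
Proof. precompose_with a. Defined.

Definition precompose_counit (a : H ⇒ functor_id) :
    precompose ⇒ functor_id.
Proof. precompose_with a. Defined.

Definition precompose_cell (a : H ∘ H ⇒ H ∘ H) :
    precompose ∘ precompose ⇒ precompose ∘ precompose.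
Proof. precompose_with a. Defined.

(** At F both sides are images under F; gathering them under one [fmap F] leaves an equation about
    H. *)
Ltac at_functor E :=
  intro F; apply nt_ext; intro x; cbn;
  rewrite <- ?fmap_id, <- ?fmap_comp; f_equal; by_cells E.

Definition precompose_monad (M : Monad H) : Monad precompose.
Proof.
unshelve refine {| mult := precompose_mult (mult M);
                   munit := precompose_unit (munit M) |}.
- at_functor (mult_assoc M).
- at_functor (mult_unit_right M).
- at_functor (mult_unit_left M).
Defined.

Definition precompose_comonad (N : Comonad H) : Comonad precompose.
Proof.
unshelve refine {| comult := precompose_comult (comult N);
                   counit := precompose_counit (counit N) |}.
- at_functor (comult_coassoc N).
- at_functor (comult_counit_right N).
- at_functor (comult_counit_left N).
Defined.

Lemma precompose_YB (τ τ' : H ∘ H ⇒ H ∘ H) :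
  IsWeakYBPair τ τ' -> IsWeakYBPair (precompose_cell τ) (precompose_cell τ').
Proof.
intros Y; split.
- at_functor (wyb_regular Y).
- at_functor (wyb_regular' Y).
- at_functor (wyb_commute Y).
- at_functor (wyb_YB Y).
- at_functor (wyb_YB' Y).
- at_functor (wyb_nabla_left Y).
- at_functor (wyb_nabla_right Y).
- at_functor (wyb_nabla_left' Y).
- at_functor (wyb_nabla_right' Y).
Qed.

Variables (M : Monad H) (N : Comonad H) (τ τ' : H ∘ H ⇒ H ∘ H).
Hypothesis W : IsWeakBraidedBimonad M N τ τ'.

Lemma precompose_bimonad :
  IsWeakBraidedBimonad (precompose_monad M) (precompose_comonad N)
    (precompose_cell τ) (precompose_cell τ').
Proof.
split; [apply precompose_YB, (wbb_YB W)|..].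
- at_functor (wbb_mult_nabla W).
- at_functor (wbb_nabla_comult W).
- at_functor (wbb_nabla_unit_left W).
- at_functor (wbb_counit_left_nabla W).
- at_functor (wbb_nabla_unit_right W).
- at_functor (wbb_counit_right_nabla W).
- at_functor (wbb_comult_right W).
- at_functor (wbb_mult_right W).
- at_functor (wbb_comult_left W).
- at_functor (wbb_mult_left W).
- at_functor (wbb_comult_mult W).
(* Mirroring turns m·mH into m·Hm, and δH·δ into Hδ·δ in the unit axioms; associativity and
   coassociativity repair this. *)
- assert (E : (counit N ⊚ counit N) · (mult M ⊚ mult M) · (H ◁ (comult N ▷ H))
      ≡ counit N · mult M · (H ◁ mult M)).
  { cells. rwl (mult_assoc M). rwl (wbb_counit_mult W). reflexivity. }
  at_functor E.
- assert (E : counit N · mult M · (H ◁ mult M)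
      ≡ (counit N ⊚ counit N) · (mult M ⊚ mult M) · (H ◁ (τ' ▷ H))
        · (H ◁ (comult N ▷ H))).
  { cells. rwl (mult_assoc M). rw (wbb_counit_mult' W). reflexivity. }
  at_functor E.
- assert (E : (H ◁ (mult M ▷ H)) · (comult N ⊚ comult N)
      · (munit M ⊚ munit M) ≡ (H ◁ comult N) · comult N · munit M).
  { cells. rwl (comult_coassoc N). rwl (wbb_comult_unit W). reflexivity. }
  at_functor E.
- assert (E : (H ◁ comult N) · comult N · munit M
      ≡ (H ◁ (mult M ▷ H)) · (H ◁ (τ' ▷ H)) · (comult N ⊚ comult N)
        · (munit M ⊚ munit M)).
  { cells. rwl (comult_coassoc N). rw (wbb_comult_unit' W). reflexivity. }
  at_functor E.
Qed.

Lemma omega_bar_entwining (ω : H ∘ H ⇒ H ∘ H) :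
  ω ≡ (H ◁ mult M) · (τ ▷ H) · (H ◁ comult N) ->
  IsWeakComonadMonadEntwining M N ω /\ IsCompatibleComonadMonad M N ω.
Proof.
intro ω_def.
destruct (omega_entwining precompose_bimonad (ω := precompose_cell ω))
  as [[E1 E2 E3 E4] E5].
{ at_functor ω_def. }
(* At the identity functor, [F ◁ a] is a up to conversion. *)
pose (idF := {| endo := @functor_id A; endo_isFunctor := _ |} : Endofunctor A).
split; [split|]; intro x.
- exact (f_equal (fun a : NatTrans _ _ => a x) (E1 idF)).
- exact (f_equal (fun a : NatTrans _ _ => a x) (E2 idF)).
- exact (f_equal (fun a : NatTrans _ _ => a x) (E3 idF)).
- exact (f_equal (fun a : NatTrans _ _ => a x) (E4 idF)).
- exact (f_equal (fun a : NatTrans _ _ => a x) (E5 idF)).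
Qed.

End Mirror.

Theorem proposition6p5 (A : Category) (H : FunctorData A A) (HF : IsFunctor H)
    (M : Monad H) (N : Comonad H) (τ τ' : H ∘ H ⇒ H ∘ H) :
  IsWeakBraidedBimonad M N τ τ' ->
  let m := mult M in
  let δ := comult N in
  let ω := (m ▷ H) · (H ◁ τ) · (δ ▷ H) in
  let ω_bar := (H ◁ m) · (τ ▷ H) · (H ◁ δ) in
  (IsWeakMonadComonadEntwining M N ω /\ IsCompatibleMonadComonad M N ω) /\
  (IsWeakComonadMonadEntwining M N ω_bar /\ IsCompatibleComonadMonad M N ω_bar).
Proof.
intros W m δ ω ω_bar; split.
- exact (omega_entwining W (fun x => eq_refl)).
- exact (omega_bar_entwining W (fun x => eq_refl)).
Qed.
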